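(* Let $n\ge 2$. For any $n$-player atomic splittable congestion game all of whose resource cost functions belong to $Q_n(\mathbb R_+)$, the set of Nash equilibria is non-empty and is globally asymptotically stable under the Frank--Wolfe (best-response) dynamic $\dot x\in\beta(F(x))-x$ on $K$.
   Context: Cost classes. $\mathbb R_+=[0,\infty)$. $\mathcal D(\mathbb R_+)$ is the set of $f\in C^2(\mathbb R_+)$ (real-valued) with $f'(x)\ge0$ and $2f'(x)+xf''(x)\ge0$ for all $x\in\mathbb R_+$. For $n\ge2$, $\gamma_n:=\frac{2(n+1)}{n-1}$ and $Q_n(\mathbb R_+):=\{f\in\mathcal D(\mathbb R_+):\gamma_nf'(x)-xf''(x)\ge0\ \forall x\in\mathbb R_+\}$. Games. An $n$-player atomic splittable congestion game is a tuple $(N,E,(K_i)_{i\in N},(c_e)_{e\in E})$ with $N=\{1,\dots,n\}$, a finite resource set $E$, nonempty convex compact strategy sets $K_i\subset\mathbb R_+^E$, and cost functions $c_e\in\mathcal D(\mathbb R_+)$. Put $K:=\prod_iK_i$ and $\bar x_e:=\sum_{i\in N}x_{i,e}$ for $x\in K$. Player $i$'s private cost is $\pi_i(x)=\sum_{e\in E}c_e(\bar x_e)x_{i,e}$; $x\in K$ is a Nash equilibrium if $\pi_i(x)\le\pi_i(y_i,x_{-i})$ for all $i\in N$, $y_i\in K_i$. The marginal cost operator is $F_{i,e}(x):=c_e(\bar x_e)+x_{i,e}c_e'(\bar x_e)$. Dynamic. $\beta(z):=\arg\min_{y\in K}\langle z,y\rangle$ (set-valued). The Frank--Wolfe dynamic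 is the differential inclusion $\dot x\in\beta(F(x))-x$ on $K$ (solutions are absolutely continuous curves in $K$ satisfying the inclusion for almost every $t\ge 0$). Global asymptotic stability. A set $X^*\subseteq K$ is globally asymptotically stable if (i) for every $\varepsilon>0$ there is $\delta>0$ such that every solution with $\operatorname{dist}(x(0),X^* )\le\delta$ satisfies $\operatorname{dist}(x(t),X^* )\le\varepsilon$ for all $t\ge0$; and (ii) for every initial condition $x(0)\in K$, every corresponding solution satisfies $\lim_{t\to\infty}\operatorname{dist}(x(t),X^* )=0$, where $\operatorname{dist}(x,X^* )=\inf_{y\in X^*}\|x-y\|$. *)

(* Defs.v *)
From mathcomp Require Import all_boot all_order all_algebra.
From mathcomp Require Import all_classical all_reals all_analysis.

Set Implicit Arguments.
Unset Strict Implicit.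
Unset Printing Implicit Defensive.

Import Order.TTheory GRing.Theory Num.Theory.
Import numFieldNormedType.Exports.

Local Open Scope classical_set_scope.
Local Open Scope ring_scope.

(* A function on R_+ = [0, +oo[ is encoded as a
   function R -> R; every notion below depends only on its values on R_+. *)

Section CostClasses.
Context {R : realType}.
Implicit Types (f : R -> R) (x : R).

Definition Rplus : set R := [set x | 0 <= x].

Definition diff_quotient f x (y : R) : R := (f y - f x) / (y - x).

(* The increment stays inside R_+, so at 0 this is the right derivative and at
   x > 0 it is the ordinary derivative. *)
Definition derivable_Rplus f x : Prop :=
  cvg (diff_quotient f x @ within Rplus (dnbhs x)).

Definition derive_Rplus f : R -> R :=
  fun x => lim (diff_quotient f x @ within Rplus (dnbhs x)).

Definition C2_Rplus f : Prop :=
  [/\ forall x, 0 <= x -> derivable_Rplus f x,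
      forall x, 0 <= x -> derivable_Rplus (derive_Rplus f) x &
      {within Rplus, continuous (derive_Rplus (derive_Rplus f))}].

Definition D_class : set (R -> R) := [set f |
  C2_Rplus f /\
  forall x, 0 <= x ->
    0 <= derive_Rplus f x /\
    0 <= 2 * derive_Rplus f x + x * derive_Rplus (derive_Rplus f) x].

Definition gamma (n : nat) : R := 2 * (n%:R + 1) / (n%:R - 1).

Definition Q_class (n : nat) : set (R -> R) := [set f |
  D_class f /\
  forall x, 0 <= x ->
    0 <= gamma n * derive_Rplus f x - x * derive_Rplus (derive_Rplus f) x].

End CostClasses.

(* Players are the elements of 'I_n. R^E is the function space E -> R, with the
   product topology for compactness. *)
Record game (R : realType) (n : nat) (E : finType) := Game {
  strategies : 'I_n -> set (E -> R) ;
  cost : E -> R -> R ;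
  strategies_nonempty : forall i, strategies i !=set0 ;
  strategies_convex : forall i, @convex_set R (E -> R^o) (strategies i) ;
  strategies_compact :
    forall i, @compact (prod_topology (fun _ : E => R)) (strategies i) ;
  strategies_ge0 : forall i y, strategies i y -> forall e, 0 <= y e ;
  cost_D : forall e, D_class (cost e) }.

Section Profiles.
Context {R : realType} {n : nat} {E : finType}.

Definition profile : Type := 'I_n -> E -> R.

Definition dotp (z y : profile) : R := \sum_i \sum_e z i e * y i e.

Definition profile_norm (x : profile) : R := Num.sqrt (dotp x x).

Definition dist (x : profile) (X : set profile) : R :=
  inf [set profile_norm (fun i e => x i e - y i e) | y in X].

(* Absolute continuity on [0, T] for every T >= 0; the intervals ]a k, b k[ of
   the finite family are pairwise disjoint and possibly empty. *)
Definition absolutely_continuous_curve (x : R -> profile) : Prop :=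
  forall T : R, 0 <= T -> forall eps : R, 0 < eps ->
  exists2 delta : R, 0 < delta &
    forall (m : nat) (a b : 'I_m -> R),
      (forall k, 0 <= a k /\ a k <= b k /\ b k <= T) ->
      trivIset setT (fun k => `]a k, b k[%classic : set R) ->
      \sum_k (b k - a k) < delta ->
      \sum_k profile_norm (fun i e => x (b k) i e - x (a k) i e) < eps.

Definition globally_asymptotically_stable
    (solution : set (R -> profile)) (X : set profile) : Prop :=
  (forall eps : R, 0 < eps ->
     exists2 delta : R, 0 < delta &
       forall x, solution x -> dist (x 0) X <= delta ->
         forall t : R, 0 <= t -> dist (x t) X <= eps) /\
  (forall x, solution x -> dist (x t) X @[t --> +oo] --> (0 : R)).

End Profiles.
Arguments profile : clear implicits.

Section Games.
Context {R : realType} {n : nat} {E : finType} (G : game R n E).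
Implicit Types (x y z : profile R n E) (i : 'I_n) (e : E).

Definition profiles : set (profile R n E) :=
  [set x | forall i, strategies G i (x i)].

Definition load x e : R := \sum_i x i e.

Definition private_cost i x : R := \sum_e cost G e (load x e) * x i e.

Definition nash_equilibria : set (profile R n E) := [set x |
  profiles x /\
  forall i (yi : E -> R), strategies G i yi ->
    private_cost i x <= private_cost i (dfwith x i yi)].

Definition marginal_cost x : profile R n E := fun i e =>
  cost G e (load x e) + x i e * derive_Rplus (cost G e) (load x e).

Definition best_response z : set (profile R n E) := [set y |
  profiles y /\ forall y', profiles y' -> dotp z y <= dotp z y'].

(* The differential inclusion holds at almost every t >= 0; the values of x at
   negative times are irrelevant. *)
Definition frank_wolfe_solution : set (R -> profile R n E) := [set x |
  [/\ forall t : R, 0 <= t -> profiles (x t),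
      absolutely_continuous_curve x &
      {ae lebesgue_measure, forall t : R, 0 <= t ->
         exists2 y, best_response (marginal_cost (x t)) y &
           forall i e, is_derive t (1 : R) (fun s => x s i e : R)
                         (y i e - x t i e)}]].

End Games.

(* Main.v *)
Require Import Defs.
From mathcomp Require Import all_boot all_order all_algebra.
From mathcomp Require Import all_classical all_reals all_analysis.
From mathcomp Require Import ring lra.

Set Implicit Arguments.
Unset Strict Implicit.
Unset Printing Implicit Defensive.

Import Order.TTheory GRing.Theory Num.Theory.
Import numFieldNormedType.Exports.

Local Open Scope classical_set_scope.
Local Open Scope ring_scope.

(** Write K for the set of profiles, F for the marginal costs and <z, y> for the
    pairing [dotp].

    The class Q_n is exactly what makes F monotone on K: on one resource the
    Jacobian of F is a quadratic form that stays nonnegative as long as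
    x f''(x) lies between - 2 f'(x) and gamma n * f'(x)
    ([gamma_quadratic_ge0], [marginal_monotone]).  Monotonicity with a single
    player moving says that private costs are convex in the own strategy, so the
    Nash equilibria are the solutions p of the variational inequality
    <F p, p - z> <= 0 for all z in K ([nash_equilibriaE]).

    Existence.  For monotone F this inequality can be solved without a fixed
    point theorem: it is enough to find p with 0 <= <F y, y - p> for all y in K,
    by compactness it is enough to treat finitely many y up to a tolerance, and
    then a potential measuring the violations can be decreased by moving towards
    a suitable one of these y, unless it is already 0 ([phi_step],
    [minty_solution], [stampacchia_solution]).

    Stability.  The gap V(x), the supremum of <F x, x - z> over z in K, vanishes
    exactly at the equilibria and is small exactly near them ([gap_le_dist],
    [dist_le_gap]).  Along a solution with velocity y - x, where y is a best
    response, the envelope principle gives formally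
      dV/dt = - <DF(x) (y - x), y - x> - V <= - V.
    The gap is only Lipschitz, so this is proved as a bound on left slopes at
    almost every time ([gap_left_increment]) and integrated with the help of
    absolute continuity ([ac_on_left_increment]).  Hence V decreases to 0 along
    every solution, and the equilibria are stable and attract all solutions
    ([fw_curves_stable]). *)

(** * Calculus on the half-line *)

Section HalfLineCalculus.
Context {R : realType}.
Implicit Types (f g : R -> R) (x y : R).

(** The limit that defines the one-sided derivative, unfolded once and for all
    into an epsilon-delta statement valid at 0 and at positive points alike. *)
Lemma diff_quotient_Rplus_near f x e : derivable_Rplus f x -> 0 < e ->
  exists2 r, 0 < r & forall y, `|x - y| < r -> y != x -> 0 <= y ->
    `|derive_Rplus f x - (f y - f x) / (y - x)| < e.
Proof.
move=> fx e0.
have q : diff_quotient f x y @[y --> within Rplus (dnbhs x)] --> derive_Rplus f x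
  by exact: fx.
by move/cvgrPdist_lt : q => /(_ e e0) /nbhs_ballP[r /= r0 H]; exists r.
Qed.

(** Away from 0 a small increment never leaves the half-line, so the derivative
    taken inside R_+ is the ordinary two-sided one and the usual rules apply. *)
Lemma is_derive_Rplus f x : 0 < x -> derivable_Rplus f x ->
  is_derive x (1 : R) f (derive_Rplus f x).
Proof.
move=> x0 fx.
have q' : h^-1 *: ((f \o shift x) (h *: (1:R)) - f x) @[h --> (0:R)^'] -->
    derive_Rplus f x.
  apply/cvgrPdist_lt => e e0.
  have [r r0 H] := diff_quotient_Rplus_near fx e0.
  apply/nbhs_ballP; exists (Num.min r x); first by rewrite /= lt_min r0.
  move=> h; rewrite -ball_normE /ball_/= sub0r normrN lt_min => /andP[hr hx] h0.
  have := H (h + x); rewrite addrK opprD addrCA subrr addr0 normrN.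
  rewrite /GRing.scale/= mulr1 [_^-1 * _]mulrC; apply => //.
  - by apply: contra h0 => /eqP E; apply/eqP; lra.
  - by move: hx; rewrite ltr_norml => /andP[]; lra.
split; first by apply/cvg_ex; exists (derive_Rplus f x).
exact: (cvg_lim (@Rhausdorff R) q').
Qed.

Lemma derivable_Rplus_continuous f : (forall x, 0 <= x -> derivable_Rplus f x) ->
  {within Rplus, continuous f}.
Proof.
move=> df; apply/subspace_continuousP => x x0.
have [r r0 H] := diff_quotient_Rplus_near (df x x0) ltr01.
set l := derive_Rplus f x in H.
apply/cvgrPdist_lt => e e0.
have D0 : 0 < `|l| + 1 by rewrite ltr_wpDl.
apply/nbhs_ballP; exists (Num.min r (e / (`|l| + 1))).
  by rewrite /= lt_min r0 divr_gt0.
move=> y; rewrite -ball_normE /ball_/= lt_min => /andP[yr ye] y0.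
have [->|yx] := eqVneq y x; first by rewrite subrr normr0.
have Hq := H y yr yx y0.
have yx0 : y - x != 0 by rewrite subr_eq0.
have E : `|(f y - f x) / (y - x)| <= `|l| + 1.
  rewrite -[X in `|X| <= _](subrK l) (le_trans (ler_normD _ _))// addrC lerD2l.
  by rewrite distrC ltW.
rewrite distrC -[_ - _](divfK yx0) normrM.
rewrite (@le_lt_trans _ _ ((`|l| + 1) * `|y - x|))//; first by rewrite ler_wpM2r.
by rewrite -ltr_pdivlMl// mulrC distrC.
Qed.

Lemma Rplus_within_itv f a b : 0 <= a -> {within Rplus, continuous f} ->
  {within `[a, b], continuous f}.
Proof.
move=> a0; apply: continuous_subspaceW => x /=.
by rewrite in_itv/= => /andP[ax _]; exact: le_trans ax.
Qed.

(** Only interior points enter the mean value theorem, hence the one-sided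
    nature of the derivative at 0 does no harm. *)
Lemma MVT_Rplus f a b : (forall x, 0 <= x -> derivable_Rplus f x) ->
  0 <= a -> a < b ->
  exists2 c, a < c < b & f b - f a = derive_Rplus f c * (b - a).
Proof.
move=> df a0 ab.
have [|//|c] := @MVT R f (derive_Rplus f) a b ab.
- move=> x; rewrite in_itv/= => /andP[ax _]; apply: is_derive_Rplus.
    exact: le_lt_trans ax.
  by apply: df; exact/ltW/(le_lt_trans a0).
- by apply: Rplus_within_itv => //; exact: derivable_Rplus_continuous.
- by rewrite in_itv/=; exists c.
Qed.

Lemma bounded_Rplus f M : {within Rplus, continuous f} ->
  exists B, forall x, 0 <= x <= M -> `|f x| <= B.
Proof.
move=> cf; have [M0|M0] := ltP M 0.
  by exists 0 => x /andP[x0 xM]; have := le_trans x0 xM; lra.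
have cf' := @Rplus_within_itv f 0 M (lexx _) cf.
have [c1 _ H1] := EVT_max M0 cf'; have [c2 _ H2] := EVT_min M0 cf'.
exists (`|f c1| + `|f c2|) => x x0M.
have xI : x \in `[0, M]%R by rewrite in_itv.
have := H1 _ xI; have := H2 _ xI.
have := ler_norm (f c1); have := ler_norm (- f c2); rewrite normrN.
have := normr_ge0 (f c1); have := normr_ge0 (f c2).
by rewrite ler_norml => *; apply/andP; split; lra.
Qed.

Lemma lipschitz_Rplus f M : (forall x, 0 <= x -> derivable_Rplus f x) ->
  {within Rplus, continuous (derive_Rplus f)} ->
  exists2 L, 0 <= L & forall x y, 0 <= x <= M -> 0 <= y <= M ->
    `|f x - f y| <= L * `|x - y|.
Proof.
move=> df cdf; have [B HB] := bounded_Rplus M cdf.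
exists `|B| => //.
suff H x y : 0 <= x -> y <= M -> x < y -> `|f x - f y| <= `|B| * `|x - y|.
  move=> x y /andP[x0 xM] /andP[y0 yM].
  have [xy|yx|->] := ltgtP x y; first exact: H.
    by rewrite distrC (distrC x); exact: H.
  by rewrite !subrr normr0 mulr0.
move=> x0 yM xy; have [c /andP[xc cy] E] := MVT_Rplus df x0 xy.
rewrite distrC E normrM (distrC x) ler_wpM2r// (le_trans (HB c _)) ?ler_norm//.
by apply/andP; split; lra.
Qed.

End HalfLineCalculus.

(** * The quadratic form of the marginal costs *)

Section QuadraticForm.
Context {R : realType} {n : nat}.
Context (hn : (2 <= n)%N).
Implicit Types (x d : 'I_n -> R).

(** Cauchy-Schwarz over the n - 1 indices other than i. *)
Lemma sqr_sum_others d i :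
  (\sum_j d j - d i) ^+ 2 <= (n%:R - 1) * (\sum_j d j ^+ 2 - d i ^+ 2).
Proof.
have N1 : (0 : R) < n%:R - 1 by rewrite subr_gt0 ltr1n.
rewrite (bigD1 i)//= [X in _ <= _ * (X - _)](bigD1 i)//= ![_ + \sum_(_ | _) _]addrC !addrK.
set b := \sum_(j | j != i) d j; set T := \sum_(j | j != i) _.
have card : \sum_(j | j != i) (1 : R) = n%:R - 1.
  have := sumr_const 'I_n (1 : R); rewrite cardT size_enum_ord (bigD1 i)//= => <-.
  by rewrite addrC addrK.
(* the variance of the other entries is nonnegative *)
have : 0 <= \sum_(j | j != i) ((n%:R - 1) * d j - b) ^+ 2.
  by apply: sumr_ge0 => j _; exact: sqr_ge0.
rewrite (eq_bigr (fun j => (n%:R - 1) ^+ 2 * d j ^+ 2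
    - 2 * (n%:R - 1) * b * d j + b ^+ 2 * 1)); last by move=> j _; ring.
rewrite big_split sumrB -!mulr_sumr -/b -/T card /=.
move: (n%:R - 1) N1 => N N0.
rewrite (_ : _ + _ = N * (N * T - b ^+ 2)); last by ring.
by rewrite pmulr_rge0// subr_ge0.
Qed.

(** The quadratic form of the Jacobian of the marginal costs on one resource,
    with p and q the first and second derivative of the cost at the load s.
    Multiplied by s it becomes linear in the weights x i, so it suffices to
    treat a load carried by a single player i; there it is affine in s * q,
    which ranges over [-2 p, gamma n * p].  At the lower end it dominates
    p * (D - d i)^2.  At the upper end [sqr_sum_others] bounds it below by a
    quadratic form in d i and D - d i whose discriminant is 0: this is where the
    value of gamma n comes from. *)
Lemma gamma_quadratic_ge0 x d (p q : R) :
  (forall i, 0 <= x i) -> 0 < \sum_i x i -> 0 <= p ->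
  0 <= 2 * p + (\sum_i x i) * q -> 0 <= gamma n * p - (\sum_i x i) * q ->
  0 <= p * (\sum_i d i) ^+ 2 + q * (\sum_i d i) * (\sum_i x i * d i)
       + p * \sum_i d i ^+ 2.
Proof.
set s := \sum_i x i; set D := \sum_i d i; set S := \sum_i d i ^+ 2.
move=> x0 s0 p0 lo hi; rewrite -(pmulr_rge0 _ s0).
have -> : s * (p * D ^+ 2 + q * D * (\sum_i x i * d i) + p * S) =
    \sum_i x i * (p * (D ^+ 2 + S) + (s * q) * (D * d i)).
  rewrite [RHS](eq_bigr (fun i => p * (D ^+ 2 + S) * x i + s * q * D * (x i * d i))).
    by rewrite big_split/= -!mulr_sumr -/s; ring.
  by move=> i _; ring.
apply: sumr_ge0 => i _; apply: mulr_ge0 => //.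
have C : (D - d i) ^+ 2 <= (n%:R - 1) * (S - d i ^+ 2) := sqr_sum_others d i.
have N1 : (0 : R) < n%:R - 1 by rewrite subr_gt0 ltr1n.
move: hi; rewrite /gamma; move: C N1 lo; move: (s * q) => r.
have -> : (n%:R : R) + 1 = (n%:R - 1) + 2 by ring.
move: (n%:R - 1) => N C N0 lo hi.
have S2 : d i ^+ 2 <= S.
  by rewrite /S (bigD1 i)//= lerDl sumr_ge0// => j _; exact: sqr_ge0.
move: C S2 lo hi; move: (d i) S D => a S D C S2 lo hi.
have [Da|Da] := leP 0 (D * a).
  suff : 0 <= p * (D ^+ 2 + S - 2 * (D * a)) + (2 * p + r) * (D * a) by lra.
  apply: addr_ge0; apply: mulr_ge0 => //.
  have := sqr_ge0 (D - a); lra.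
have hi' : N * r <= 2 * (N + 2) * p.
  move: hi; rewrite subr_ge0 -(ler_pM2l N0) => /le_trans; apply.
  rewrite le_eqVlt; apply/orP; left; apply/eqP; field. by rewrite gt_eqF.
rewrite -(pmulr_rge0 _ N0).
suff : 0 <= p * (N * (D ^+ 2 + S) + 2 * (N + 2) * (D * a))
    + (2 * (N + 2) * p - N * r) * (- (D * a)) by lra.
apply: addr_ge0; apply: mulr_ge0; rewrite ?subr_ge0//; last by rewrite oppr_ge0 ltW.
(* the vanishing discriminant: by C the form is at least n * (D + a)^2 *)
have Nd : 0 <= N * (D ^+ 2 + S) + 2 * (N + 2) * (D * a) - (N * (S - a ^+ 2) - (D - a) ^+ 2).
  rewrite (_ : _ - _ = (N + 1) * (D + a) ^+ 2); last by ring.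
  by rewrite mulr_ge0 ?sqr_ge0//; lra.
lra.
Qed.
End QuadraticForm.

(** * Monotonicity of the marginal costs on one resource *)

Section ResourceMonotonicity.
Context {R : realType} {n : nat} (hn : (2 <= n)%N) {c : R -> R}.
Context (hc : Q_class n c).
Implicit Types (u v : 'I_n -> R).

Definition marginal u i : R :=
  c (\sum_j u j) + u i * derive_Rplus c (\sum_j u j).

Lemma Q_class_derivable x : 0 <= x -> derivable_Rplus c x.
Proof. by case: hc => -[[]] + _ _ _ _; apply. Qed.

Lemma Q_class_derivable2 x : 0 <= x -> derivable_Rplus (derive_Rplus c) x.
Proof. by case: hc => -[[]] _ + _ _ _; apply. Qed.

(** Integrate the quadratic form along the segment from v to u.  When the total
    load increases, the load itself serves as parameter of the segment: the
    costs are then differentiated directly rather than inside a composition,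
    and the mean value theorem stays away from load 0. *)
Lemma marginal_monotone_lt u v :
  (forall i, 0 <= u i) -> (forall i, 0 <= v i) -> \sum_i v i < \sum_i u i ->
  0 <= \sum_i (marginal u i - marginal v i) * (u i - v i).
Proof.
move=> u0 v0.
pose d i := u i - v i; pose D := \sum_i d i; pose S := \sum_i d i ^+ 2.
pose P := \sum_i v i * d i; pose W := \sum_i v i.
have UE : \sum_i u i = W + D.
  by rewrite /W /D -big_split; apply: eq_bigr => i _; rewrite /d/= addrC subrK.
rewrite UE -/W => WU; have D0 : 0 < D by rewrite -subr_gt0 addrAC subrr add0r in WU.
have W0 : 0 <= W by exact: sumr_ge0.
pose c' := derive_Rplus c; pose c'' := derive_Rplus c'.
(* m s pairs d with the point of the segment whose total load is s; h s pairs
   d with the marginal costs at that point *)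
pose m : R -> R := cst P + (id - cst W) * cst (S / D).
pose h : R -> R := c * cst D + c' * m.
have -> : \sum_i (marginal u i - marginal v i) * (u i - v i) = h (W + D) - h W.
  have mU : m (W + D) = P + S by rewrite /m !fctE addrAC subrr add0r mulrCA divff ?gt_eqF// mulr1.
  have mW : m W = P by rewrite /m !fctE subrr mul0r addr0.
  rewrite /h !fctE mU mW.
  rewrite (eq_bigr (fun i => (c (W + D) - c W) * d i + c' (W + D) * (v i * d i + d i ^+ 2)
     - c' W * (v i * d i))); last first.
    by move=> i _; rewrite /marginal UE -/W -/c' /d; ring.
  have PS : \sum_i (v i * d i + d i ^+ 2) = P + S by rewrite big_split.
  by rewrite sumrB [X in X - _]big_split/= -!mulr_sumr PS -/P -/D; ring.
have dm s : is_derive s (1 : R) m (S / D).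
  apply: (is_derive_eq (is_deriveD (is_derive_cst P s 1) (is_deriveM
    (is_deriveB (is_derive_id s 1) (is_derive_cst W s 1)) (is_derive_cst (S / D) s 1)))).
  by rewrite /GRing.scale/=; ring.
have dh s : s \in `]W, W + D[%R ->
    is_derive s (1 : R) h (c' s * D + c'' s * m s + c' s * (S / D)).
  rewrite in_itv/= => /andP[Ws sU].
  have s0 : 0 < s := le_lt_trans W0 Ws.
  have ds := is_derive_Rplus s0 (Q_class_derivable (ltW s0)).
  have dds := is_derive_Rplus s0 (Q_class_derivable2 (ltW s0)).
  apply: (is_derive_eq (is_deriveD (is_deriveM ds (is_derive_cst D s 1))
    (is_deriveM dds (dm s)))).
  by rewrite /GRing.scale/= -/c' -/c''; ring.
have ch : {within `[W, W + D], continuous h}.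
  have cc := Rplus_within_itv (b := W + D) W0 (derivable_Rplus_continuous Q_class_derivable).
  have cc' := Rplus_within_itv (b := W + D) W0 (derivable_Rplus_continuous Q_class_derivable2).
  have cm : {within `[W, W + D], continuous m}.
    apply: continuous_subspaceT => x; apply: differentiable_continuous.
    by apply/derivable1_diffP; have [] := dm x.
  move=> x; apply: cvgD; apply: cvgM.
  + exact: cc.
  + exact: cvg_cst.
  + exact: cc'.
  + exact: cm.
have [s + hE] := MVT WU dh ch; rewrite [X in 0 <= X]hE.
rewrite in_itv/= => /andP[Ws sU].
have s0 : 0 < s := le_lt_trans W0 Ws.
have -> : W + D - W = D by ring.
pose t := (s - W) / D.
have [t0 t1] : 0 <= t /\ t <= 1.
  by rewrite /t ler_pdivrMr// divr_ge0 ?(ltW D0)//; lra.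
pose x i := v i + t * d i.
have x0 i : 0 <= x i.
  rewrite (_ : x i = (1 - t) * v i + t * u i); last by rewrite /x /d; ring.
  by rewrite addr_ge0// mulr_ge0// subr_ge0.
have xs : \sum_i x i = s.
  by rewrite big_split/= -mulr_sumr -/D -/W /t divfK ?gt_eqF// addrC subrK.
have xd : \sum_i x i * d i = m s.
  rewrite (eq_bigr (fun i => v i * d i + t * d i ^+ 2)); last by move=> i _; rewrite /x; ring.
  by rewrite big_split/= -mulr_sumr -/S -/P /m !fctE /t; ring.
case: hc => -[_ /(_ s (ltW s0))[p0 lo] /(_ s (ltW s0)) hi].
have := @gamma_quadratic_ge0 R n hn x d (c' s) (c'' s) x0.
rewrite xs xd -/D -/S => /(_ s0 p0 lo hi).
congr (0 <= _); field. by rewrite gt_eqF.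
Qed.

(** At equal loads the costs and their slopes agree and the pairing is a
    nonnegative multiple of a sum of squares. *)
Lemma marginal_monotone u v :
  (forall i, 0 <= u i) -> (forall i, 0 <= v i) ->
  0 <= \sum_i (marginal u i - marginal v i) * (u i - v i).
Proof.
move=> u0 v0.
have [uv|vu|E] := ltgtP (\sum_i u i) (\sum_i v i); last 1 first.
- rewrite (eq_bigr (fun i => derive_Rplus c (\sum_j v j) * (u i - v i) ^+ 2)).
    apply: sumr_ge0 => i _; apply: mulr_ge0; last exact: sqr_ge0.
    by case: hc => -[_ H _]; case: (H (\sum_j v j)) => //; exact: sumr_ge0.
  by move=> i _; rewrite /marginal E; ring.
- rewrite (eq_bigr (fun i => (marginal v i - marginal u i) * (v i - u i))).
    exact: marginal_monotone_lt.
  by move=> i _; ring.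
- exact: marginal_monotone_lt.
Qed.

(** A player's cost on a resource is convex in that player's own flow, because
    its derivative G is the marginal cost, whose monotonicity in the own
    flow is [marginal_monotone] for two vectors differing in one entry. *)
Lemma own_cost_tangent u v i : (forall j, 0 <= u j) -> (forall j, 0 <= v j) ->
  (forall j, j != i -> u j = v j) ->
  marginal u i * (v i - u i) <=
  c (\sum_j v j) * v i - c (\sum_j u j) * u i.
Proof.
move=> u0 v0 uv.
(* a is the common load of the opponents *)
pose a := \sum_(j | j != i) u j.
have a0 : 0 <= a by apply: sumr_ge0.
have UE : \sum_j u j = a + u i by rewrite (bigD1 i)//= addrC.
have VE : \sum_j v j = a + v i.
  by rewrite (bigD1 i)//= addrC; congr (_ + _); apply: eq_bigr => j /uv ->.
pose G x := c (a + x) + x * derive_Rplus c (a + x).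
have Gmono x y : 0 <= x -> 0 <= y -> 0 <= (G x - G y) * (x - y).
  move=> x0 y0; pose w z : 'I_n -> R := dfwith u i z.
  have wi z : w z i = z by rewrite /w dfwithin.
  have wj z j : j != i -> w z j = u j by move=> ji; rewrite /w dfwithout// eq_sym.
  have w0 z : 0 <= z -> forall j, 0 <= w z j.
    by move=> z0 j; have [->|/wj->//] := eqVneq j i; rewrite wi.
  have ws z : \sum_j w z j = a + z.
    by rewrite (bigD1 i)//= wi addrC; congr (_ + _); apply: eq_bigr => j /wj.
  have := marginal_monotone (w0 x x0) (w0 y y0).
  rewrite (bigD1 i)//= big1 ?addr0; last by move=> j ji; rewrite !wj// subrr mulr0.
  by rewrite /marginal !ws !wi.
have key x y : 0 <= x -> 0 <= y -> x < y ->
    G x * (y - x) <= c (a + y) * y - c (a + x) * x <= G y * (y - x).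
  move=> x0 y0 xy; have axy : a + x < a + y by rewrite ltrD2l.
  have ax0 : 0 <= a + x by exact: addr_ge0.
  pose p : R -> R := c * (id - cst a).
  have -> : c (a + y) * y - c (a + x) * x = p (a + y) - p (a + x).
    by rewrite /p !fctE; ring.
  have -> : y - x = (a + y) - (a + x) by ring.
  have [s||s + ->] := @MVT R p (fun s => G (s - a)) _ _ axy.
  - rewrite in_itv/= => /andP[xs _].
    have s0 : 0 < s := le_lt_trans ax0 xs.
    have ds := is_derive_Rplus s0 (Q_class_derivable (ltW s0)).
    apply: (is_derive_eq (is_deriveM ds (is_deriveB (is_derive_id s 1) (is_derive_cst a s 1)))).
    by rewrite /G /GRing.scale/= !fctE (addrC a) subrK; ring.
  - have cc := Rplus_within_itv (b := a + y) ax0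
      (derivable_Rplus_continuous Q_class_derivable).
    move=> s; apply: cvgM; first exact: cc.
    apply: cvgB; last exact: cvg_cst.
    by apply: (@continuous_subspaceT _ _ _ id) => z; exact: cvg_id.
  rewrite in_itv/= => /andP[xs sy]; rewrite !ler_pM2r ?subr_gt0//.
  have sx : x < s - a by lra.
  have ys : s - a < y by lra.
  have s0 : 0 <= s - a by lra.
  have := Gmono (s - a) x s0 x0; have := Gmono y (s - a) y0 s0.
  by rewrite !pmulr_lge0 ?subr_gt0// !subr_ge0 => -> ->.
rewrite /marginal UE VE -/(G _).
have [xy|yx|->] := ltgtP (u i) (v i); last by rewrite !subrr mulr0.
- by case/andP: (key _ _ (u0 i) (v0 i) xy).
- by case/andP: (key _ _ (v0 i) (u0 i) yx); lra.
Qed.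
End ResourceMonotonicity.

(** * Absolutely continuous functions with a bounded left slope *)

Section AbsoluteContinuity.
Context {R : realType}.
Implicit Types (phi : R -> R) (N U : set R).

Lemma sum_length_le_measure U m (a b : 'I_m -> R) : measurable U ->
  (forall k, a k <= b k) -> trivIset setT (fun k => `]a k, b k[%classic : set R) ->
  (forall k, `]a k, b k[ `<=` U) ->
  ((\sum_k (b k - a k))%:E <= lebesgue_measure U)%E.
Proof.
move=> mU ab tI sU.
have len k : lebesgue_measure (`]a k, b k[%classic : set R) = (b k - a k)%:E.
  rewrite lebesgue_measure_itv /= lte_fin; case: ltP => // ba.
  have /eqP -> : b k == a k by rewrite eq_le ba ab.
  by rewrite subrr.
rewrite -sumEFin; under eq_bigr do rewrite -len.
rewrite -measure_bigsetU_ord//.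
apply: le_measure; rewrite ?inE//.
  by apply: bigsetU_measurable => k _; exact: measurable_itv.
apply: (big_ind (fun X => X `<=` U)); [exact: sub0set| |by move=> k _; exact: sU].
by move=> B C BU CU x [/BU|/CU].
Qed.

Definition ac_on T phi : Prop := forall eps : R, 0 < eps ->
  exists2 delta : R, 0 < delta &
    forall (m : nat) (a b : 'I_m -> R),
      (forall k, 0 <= a k /\ a k <= b k /\ b k <= T) ->
      trivIset setT (fun k => `]a k, b k[%classic : set R) ->
      \sum_k (b k - a k) < delta ->
      \sum_k `|phi (b k) - phi (a k)| < eps.

Lemma ac_on_near T phi t e : ac_on T phi -> 0 <= t -> 0 < e ->
  exists2 r, 0 < r & forall s, t <= s <= T -> s < t + r -> `|phi s - phi t| < e.
Proof.
move=> ac t0 e0; have [r r0 H] := ac e e0; exists r => // s /andP[ts sT] sr.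
have := H 1%N (fun=> t) (fun=> s); rewrite !big_ord1; apply => //.
- by move=> k k' _ _ _; rewrite (ord1 k) (ord1 k').
- lra.
Qed.

(** An absolutely continuous function whose left slopes are at most k outside a
    null set grows at rate at most k.  The null set is covered by an open set U
    of small measure.  Walking left from T, a point outside the null set allows a
    step with slope at most k, and a point of U allows a step inside U; the
    increments over the steps of the second kind are small in total by absolute
    continuity.  The infimum of the points reached is itself reached, by
    continuity, so the walk ends at S. *)
Lemma ac_on_left_increment S T phi k N : 0 <= S -> S <= T -> ac_on T phi ->
  lebesgue_measure.-negligible N ->
  (forall t, S < t <= T -> ~ N t -> exists2 r, 0 < r &
     forall s, S <= s -> t - r < s < t -> phi t - phi s <= k * (t - s)) ->
  phi T - phi S <= k * (T - S).
Proof.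
move=> S0 ST ac [A [mA A0 NA]] dini.
have A0' : lebesgue_measure A = 0%E := A0.
apply/ler_addgt0Pr => e e0.
have e20 : 0 < e / 2 by rewrite divr_gt0.
have [dl dl0 Hdl] := ac _ e20.
have K0 : 0 < `|k| + 1 by rewrite ltr_wpDl.
pose dl' := Num.min dl (e / 4 / (`|k| + 1)).
have dl'0 : 0 < dl' by rewrite lt_min dl0 !divr_gt0.
have Aoo : (lebesgue_measure A < +oo)%E by rewrite A0'.
have [U [oU AU mUA]] := @lebesgue_regularity_outer R A dl' mA Aoo dl'0.
have mU : measurable U by exact: measurable_realfun.open_measurable.
have lU : (lebesgue_measure U < dl'%:E)%E.
  have E : (lebesgue_measure (A `|` (U `\` A)) =
      lebesgue_measure A + lebesgue_measure (U `\` A))%E.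
    by apply: measureU => //; [exact: measurableD|rewrite setDIK].
  by rewrite -(setDUK AU) E A0' add0e; exact: mUA.
have e40 : 0 < e / 4 by rewrite divr_gt0.
(* s is reached: up to an arbitrarily small eta, the increment on [s, T] is
   controlled except on finitely many intervals inside U; the terms with `|k|
   pay for a possibly negative slope bound on these intervals *)
pose good s := forall eta, 0 < eta -> exists m (a b : 'I_m -> R),
  [/\ forall j, [/\ s <= a j, a j <= b j & b j <= T],
      trivIset setT (fun j => `]a j, b j[%classic : set R),
      forall j, `]a j, b j[ `<=` U &
      phi T - phi s <= k * (T - s) + eta + \sum_j (`|phi (b j) - phi (a j)| + `|k| * (b j - a j))].
have goodS : good S -> phi T - phi S <= k * (T - S) + e.
  move=> /(_ _ e40)[m [a [b [H tI sU le]]]].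
  have len : \sum_j (b j - a j) < dl'.
    rewrite -lte_fin (le_lt_trans _ lU)//.
    by apply: sum_length_le_measure => // j; case: (H j).
  have /andP[len1 len2] : (\sum_j (b j - a j) < dl) &&
      (\sum_j (b j - a j) < e / 4 / (`|k| + 1)) by rewrite -lt_min.
  have Hs : \sum_j `|phi (b j) - phi (a j)| < e / 2.
    by apply: Hdl => // j; have [Sa ? ?] := H j; split=> //; exact: le_trans Sa.
  rewrite ltr_pdivlMr// in len2.
  have len0 : 0 <= \sum_j (b j - a j).
    by apply: sumr_ge0 => j _; rewrite subr_ge0; case: (H j).
  rewrite big_split/= -mulr_sumr in le.
  move: le Hs len2 len0; set X := \sum_j `|_|; set Y := \sum_j _ => le Hs len2 len0.
  lra.
apply: goodS.
pose G := [set s | S <= s <= T /\ good s].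
have GT : G T.
  split; first by rewrite ST lexx.
  move=> eta eta0; exists 0%N, (fun=> 0), (fun=> 0); split; [by case|by case|by case|].
  by rewrite big_ord0 !subrr mulr0; lra.
have hG : has_inf G.
  by split; [exists T | exists S => s [/andP[]]].
pose i := inf G.
have Si : S <= i by apply: lb_le_inf => //; [exists T|move=> s [/andP[]]].
have iT : i <= T by apply: ge_inf => //; case: hG.
(* the slack eta absorbs the passage to the limit *)
have gi : good i.
  move=> eta eta0.
  have eta40 : 0 < eta / 4 by rewrite divr_gt0.
  have [r r0 Hr] := ac_on_near ac (le_trans S0 Si) eta40.
  pose q := Num.min r (eta / 4 / (`|k| + 1)).
  have q0 : 0 < q by rewrite lt_min r0 divr_gt0.
  have [s [/andP[s0 sT] gs] sq] := inf_adherent q0 hG.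
  have is_ : i <= s by apply: ge_inf; [case: hG|split=> //; apply/andP].
  have [m [a [b [H tI sU le]]]] := gs _ eta40.
  exists m, a, b; split => // [j|].
    by have [sa ab bT] := H j; split=> //; exact: le_trans sa.
  have [qr qk] : s - i <= r /\ (s - i) * (`|k| + 1) <= eta / 4.
    move: (ltW sq); rewrite -lerBlDl le_min => /andP[-> qk]; split => //.
    by rewrite -ler_pdivlMr.
  have := Hr s; rewrite is_ sT => /(_ isT); have -> : s < i + r.
    by rewrite (lt_le_trans sq)// lerD2l ge_min lexx.
  move=> /(_ isT) /ltW; rewrite ler_norml => /andP[_ Hs].
  have : - (k * (s - i)) <= `|k| * (s - i).
    by rewrite -mulNr -normrN ler_wpM2r ?ler_norm ?subr_ge0.
  move: le; set Z := \sum_j _ => le Hk; lra.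
have [iS|] := leP i S; first by have <- : i = S by apply/eqP; rewrite eq_le iS.
move=> ip.
have [s [si s0 gs]] : exists s, [/\ s < i, S <= s & good s].
  have [Ni|Ni] := pselect (N i).
    have : nbhs i U by apply: open_nbhs_nbhs; split => //; apply: AU; exact: NA.
    move=> /nbhs_ballP[r /= r0 Hr].
    exists (Num.max S (i - r / 2)); split.
    - by rewrite gt_max ip; lra.
    - by rewrite le_max lexx.
    move=> eta eta0; have [m [a [b [H tI sU le]]]] := gi _ eta0.
    set s := Num.max _ _; have s0 : S <= s by rewrite /s le_max lexx.
    have si : s < i by rewrite /s gt_max ip; lra.
    have sr : i - r < s by rewrite /s lt_max; apply/orP; right; lra.
    pose cons (x : R) (f : 'I_m -> R) (j : 'I_m.+1) := oapp f x (unlift ord0 j).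
    have cons0 x f : cons x f ord0 = x by rewrite /cons unlift_none.
    have consS x f j : cons x f (lift ord0 j) = f j by rewrite /cons liftK.
    have dj j x : x \in `]s, i[ -> x \in `]a j, b j[ -> False.
      rewrite !in_itv/= => /andP[_ xi] /andP[ax _].
      by have [ia _ _] := H j; have := lt_le_trans (lt_trans ax xi) ia; rewrite ltxx.
    exists m.+1, (cons s a), (cons i b); split.
    - move=> j; case: (unliftP ord0 j) => [j'|] ->; rewrite ?cons0 ?consS.
        by have [ia ab bT] := H j'; split=> //; apply: le_trans ia; exact: ltW.
      by split=> //; exact: ltW.
    - move=> j j' _ _; case: (unliftP ord0 j) => [l|] ->;
        case: (unliftP ord0 j') => [l'|] ->; rewrite ?cons0 ?consS //.
      + by move=> X; congr (lift _ _); exact: tI.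
      + by move=> [x [/= ? ?]]; case: (dj l x).
      + by move=> [x [/= ? ?]]; case: (dj l' x).
    - move=> j; case: (unliftP ord0 j) => [j'|] ->; rewrite ?cons0 ?consS; first exact: sU.
      move=> x; rewrite /= in_itv/= => /andP[sx xi]; apply: Hr.
      by rewrite -ball_normE /ball_/= ltr_norml; apply/andP; split; lra.
    - rewrite big_ord_recl !cons0; under eq_bigr do rewrite !consS.
      have := ler_norm (phi i - phi s).
      have : - (k * (i - s)) <= `|k| * (i - s).
        by rewrite -mulNr -normrN ler_wpM2r ?ler_norm// subr_ge0 ltW.
      move: le; set Z := \sum_j _ => le Hk; lra.
  have [|r r0 Hr] := dini i _ Ni; first by rewrite ip.
  exists (Num.max S (i - r / 2)).
  set s := Num.max _ _; have s0 : S <= s by rewrite /s le_max lexx.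
  have si : s < i by rewrite /s gt_max ip; lra.
  split=> // eta eta0; have [m [a [b [H tI sU le]]]] := gi _ eta0.
  exists m, a, b; split => // [j|].
    by have [ia ab bT] := H j; split=> //; apply: le_trans ia; exact: ltW.
  have sr : i - r < s by rewrite /s lt_max; apply/orP; right; lra.
  have := Hr s s0; rewrite si sr => /(_ isT) Hs.
  by move: le; set Z := \sum_j _ => le; lra.
have : i <= s by apply: ge_inf; [case: hG|split=> //; apply/andP; split=> //; lra].
lra.
Qed.
End AbsoluteContinuity.

(** * Strategy profiles as vectors *)

Section ProfileAlgebra.
Context {R : realType} {n : nat} {E : finType}.
Implicit Types (x y z : profile R n E) (h B : R).

Definition psub x y : profile R n E := fun i e => x i e - y i e.

Definition toward x h y : profile R n E := fun i e => x i e + h * (y i e - x i e).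

Definition norm1 x : R := \sum_i \sum_e `|x i e|.

Lemma norm1_ge0 x : 0 <= norm1 x.
Proof. by apply: sumr_ge0 => i _; exact: sumr_ge0. Qed.

Lemma dotpC x y : dotp x y = dotp y x.
Proof. by apply: eq_bigr => i _; apply: eq_bigr => e _; rewrite mulrC. Qed.

Lemma dotpBr z x y : dotp z (psub x y) = dotp z x - dotp z y.
Proof.
rewrite /dotp -sumrB; apply: eq_bigr => i _; rewrite -sumrB.
by apply: eq_bigr => e _; rewrite mulrBr.
Qed.

Lemma dotpBl z x y : dotp (psub x y) z = dotp x z - dotp y z.
Proof. by rewrite dotpC dotpBr !(dotpC z). Qed.

Lemma dotp_toward z x h y :
  dotp z (toward x h y) = dotp z x + h * (dotp z y - dotp z x).
Proof.
rewrite /dotp -sumrB mulr_sumr -big_split; apply: eq_bigr => i _ /=.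
rewrite -sumrB mulr_sumr -big_split; apply: eq_bigr => e _ /=.
by rewrite /toward; ring.
Qed.

Lemma norm1_psubC x y : norm1 (psub x y) = norm1 (psub y x).
Proof. by apply: eq_bigr => i _; apply: eq_bigr => e _; exact: distrC. Qed.

Lemma dotp_norm1 z x B : (forall i e, `|z i e| <= B) -> `|dotp z x| <= B * norm1 x.
Proof.
move=> zB; rewrite /norm1 mulr_sumr (le_trans (ler_norm_sum _ _ _))//.
apply: ler_sum => i _; rewrite mulr_sumr (le_trans (ler_norm_sum _ _ _))//.
by apply: ler_sum => e _; rewrite normrM ler_wpM2r.
Qed.

Lemma ler_coord_norm1 x i e : `|x i e| <= norm1 x.
Proof.
rewrite /norm1 (bigD1 i)//= (bigD1 e)//= -addrA lerDl.
by rewrite addr_ge0// sumr_ge0// => *; rewrite ?sumr_ge0.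
Qed.

(** The number of coordinates, the factor lost when [norm1] is compared with the
    maximum norm or the Euclidean norm. *)
Definition pdim : R := n%:R * #|E|%:R.

Lemma pdim_ge0 : 0 <= pdim. Proof. by rewrite mulr_ge0. Qed.

Lemma norm1_le x B : (forall i e, `|x i e| <= B) -> norm1 x <= pdim * B.
Proof.
move=> xB; rewrite /norm1 /pdim.
rewrite (@le_trans _ _ (\sum_(i < n) \sum_(e : E) B))//.
  by apply: ler_sum => i _; apply: ler_sum => e _.
by rewrite !sumr_const card_ord -[leLHS]mulr_natl -(mulr_natl B) mulrA.
Qed.

Lemma ler_coord_norm x i e : `|x i e| <= profile_norm x.
Proof.
rewrite -sqrtr_sqr ler_wsqrtr// /dotp (bigD1 i)//= (bigD1 e)//= -expr2 -addrA lerDl.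
by rewrite addr_ge0// sumr_ge0// => *; rewrite ?sumr_ge0// => *; rewrite -expr2 sqr_ge0.
Qed.

Lemma profile_norm_le x : profile_norm x <= norm1 x.
Proof.
rewrite /profile_norm -(ger0_norm (norm1_ge0 x)) -sqrtr_sqr ler_wsqrtr//.
rewrite expr2 (le_trans (ler_norm _))//.
by rewrite dotp_norm1// => i e; exact: ler_coord_norm1.
Qed.

Lemma norm1_le_norm x : norm1 x <= pdim * profile_norm x.
Proof. by apply: norm1_le => i e; exact: ler_coord_norm. Qed.

Lemma dist_ge0 x (X : set (profile R n E)) : X !=set0 -> 0 <= dist x X.
Proof.
move=> [p Xp]; apply: lb_le_inf; first by exists (profile_norm (psub x p)), p.
by move=> _ [y _ <-]; exact: sqrtr_ge0.
Qed.

Lemma dist_le x p (X : set (profile R n E)) : X p -> dist x X <= norm1 (psub x p).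
Proof.
move=> Xp; apply: le_trans (profile_norm_le _).
apply: ge_inf; last by exists p.
by exists 0 => _ [y _ <-]; exact: sqrtr_ge0.
Qed.

(** The infimum defining the distance is approached, which avoids discussing
    whether it is attained. *)
Lemma dist_near x (X : set (profile R n E)) e : X !=set0 -> 0 < e ->
  exists2 p, X p & norm1 (psub x p) <= pdim * (dist x X + e).
Proof.
move=> [p Xp] e0.
have hI : has_inf [set profile_norm (psub x y) | y in X].
  split; first by exists (profile_norm (psub x p)), p.
  by exists 0 => _ [y _ <-]; exact: sqrtr_ge0.
have [_ [y Xy <-] ye] := inf_adherent e0 hI.
exists y => //; apply: (le_trans (norm1_le_norm _)).
by rewrite ler_wpM2l ?pdim_ge0// ltW.
Qed.

End ProfileAlgebra.
Arguments pdim R n E : clear implicits.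

Section ProfileTopology.
Context {R : realType} {n : nat} {E : finType}.

(** The product topology for which a product of compact strategy sets is compact
    by Tychonoff's theorem. *)
Definition profile_top := prod_topology (fun _ : 'I_n => prod_topology (fun _ : E => R)).

Lemma nbhs_box (p : profile_top) (r : R) : 0 < r ->
  nbhs p [set x : profile_top | forall i e, `|p i e - x i e| < r].
Proof.
move=> r0.
apply: (@filter_forall _ _ (fun i (x : profile_top) => forall e, `|p i e - x i e| < r)
  _ (nbhs_filter p)) => i.
apply: (@filter_forall _ _ (fun e (x : profile_top) => `|p i e - x i e| < r)
  _ (nbhs_filter p)) => e.
pose pi_ (x : profile_top) : prod_topology (fun _ : E => R) := x i.
pose pe (x : prod_topology (fun _ : E => R)) : R := x e.
have : (pe \o pi_) x @[x --> p] --> pe (pi_ p).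
  have c1 : continuous pi_ by exact: proj_continuous.
  have c2 : continuous pe by exact: proj_continuous.
  by apply: (@continuous_comp _ _ _ pi_ pe); [exact: c1|exact: c2].
by move/cvgrPdist_lt => /(_ r r0).
Qed.

(** The form in which compactness is used throughout: a directed family of
    nonempty subsets of a compact set of profiles comes arbitrarily close,
    coordinate by coordinate, to one and the same point. *)
Lemma compact_approx (K : set (profile R n E)) (I : Type) (D : set I)
    (B : I -> set (profile R n E)) :
  compact (K : set profile_top) -> D !=set0 ->
  (forall i j, D i -> D j -> exists2 k, D k & B k `<=` B i `&` B j) ->
  (forall i, D i -> B i !=set0) -> (forall i, D i -> B i `<=` K) ->
  exists2 p, K p & forall i, D i -> forall r : R, 0 < r ->
    exists2 x, B i x & forall i e, `|p i e - x i e| <= r.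
Proof.
move=> cK [i0 Di0] dir B0 BK.
have FF : Filter (filter_from D B) by apply: filter_from_filter => //; exists i0.
have PF : ProperFilter (filter_from D B) by exact: filter_from_proper.
have FK : filter_from D B K by exists i0 => //; exact: BK.
have [p [Kp clp]] := cK _ PF FK; exists p => // i Di r r0.
have FB : filter_from D B (B i) by exists i.
have [x [Bx px]] := clp _ _ FB (@nbhs_box p r r0).
by exists x => // j e; exact/ltW/px.
Qed.

End ProfileTopology.

(** * Monotone variational inequalities on a compact convex set *)

Section VariationalInequality.
Context {R : realType} {n : nat} {E : finType}.
Context (K : set (profile R n E)) (F : profile R n E -> profile R n E) (L : R).
Context (K0 : K !=set0).
Context (Kconvex : forall x y h, K x -> K y -> 0 <= h <= 1 -> K (toward x h y)).
Context (Kcompact : compact (K : set (@profile_top R n E))).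
Context (L0 : 0 <= L).
Context (Flip : forall x y, K x -> K y -> forall i e,
  `|F x i e - F y i e| <= L * norm1 (psub x y)).
Context (Fmono : forall x y, K x -> K y -> 0 <= dotp (psub (F x) (F y)) (psub x y)).
Implicit Types (x y z : profile R n E).

Lemma K_bounded : exists2 B : R, 0 <= B & forall x, K x -> forall i e, `|x i e| <= B.
Proof.
apply: contrapT => nB.
pose B (M : R) := [set x | K x /\ exists i e, M < `|x i e|].
have B0 M : B M !=set0.
  apply: contrapT => /forallNP HM; apply: nB; exists `|M| => // x Kx i e.
  rewrite leNgt; apply/negP => lt; apply: (HM x); split=> //; exists i, e.
  by apply: le_lt_trans lt; exact: ler_norm.
have [||//||p Kp Hp] := compact_approx (D := setT) (B := B) Kcompact.
- by exists 0.
- move=> M N _ _; exists (Num.max M N) => // x [Kx [i [e]]].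
  by rewrite gt_max => /andP[HM HN]; split; split=> //; exists i, e.
- by move=> M _ x [].
have [x [Kx [i [e Hx]]] px] := Hp (norm1 p + 1) I 1 ltr01.
have := px i e; move: Hx.
have : `|p i e| <= norm1 p by exact: ler_coord_norm1.
by move=> H1 H2 H3; have := ler_distD (p i e) (x i e) 0; rewrite !subr0 distrC; lra.
Qed.

Lemma K_diameter : exists2 N : R, 0 <= N & forall x y, K x -> K y -> norm1 (psub x y) <= N.
Proof.
have [B B0 HB] := K_bounded; exists (pdim R n E * (B + B)).
  by rewrite mulr_ge0 ?addr_ge0// pdim_ge0.
move=> x y Kx Ky; apply: norm1_le => i e.
by rewrite (le_trans (ler_normB _ _))// lerD// HB.
Qed.

Lemma F_bounded : exists2 C : R, 0 <= C & forall x, K x -> forall i e, `|F x i e| <= C.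
Proof.
have [p Kp] := K0; have [N N0 HN] := K_diameter.
exists (norm1 (F p) + L * N); first by rewrite addr_ge0 ?norm1_ge0// mulr_ge0.
move=> x Kx i e; rewrite -(subrK (F p i e) (F x i e)) addrC.
rewrite (le_trans (ler_normD _ _))// lerD//.
  exact: ler_coord_norm1.
by rewrite (le_trans (Flip Kx Kp _ _))// ler_wpM2l// HN.
Qed.

(** ** Existence of solutions *)

Section FiniteMinty.
Context (m : nat) (y : 'I_m -> profile R n E) (Ky : forall j, K (y j)).

(* mu x j measures by how much x violates the j-th inequality 0 <= b x j, and
   the potential phi vanishes exactly when all of them hold *)
Let b x j := dotp (F (y j)) (psub (y j) x).
Let mu x j := Num.max 0 (- b x j).
Let phi x := \sum_j mu x j ^+ 2.

Lemma phi_ge0 x : 0 <= phi x.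
Proof. by apply: sumr_ge0 => j _; exact: sqr_ge0. Qed.

Lemma mu_ge0 x j : 0 <= mu x j. Proof. by rewrite /mu le_max lexx. Qed.

Lemma mu_mul x j : mu x j * b x j = - mu x j ^+ 2.
Proof.
by rewrite /mu; case: (leP 0 (- b x j)) => _; rewrite ?expr2; ring.
Qed.

(** Monotonicity says that the matrix b (y k) j has a nonnegative symmetric part,
    so its pairing with the nonnegative vector mu x on both sides is nonnegative
    and some column k must pair nonnegatively with mu x. *)
Lemma good_vertex x : phi x != 0 -> exists k, 0 <= \sum_j mu x j * b (y k) j.
Proof.
move=> phi0; apply: contrapT => /forallNP none.
have neg k : \sum_j mu x j * b (y k) j < 0.
  by rewrite ltNge; apply/negP/none.
have skew j k : 0 <= b (y k) j + b (y j) k.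
  have := Fmono (Ky j) (Ky k); rewrite dotpBl.
  by rewrite /b !dotpBr; lra.
pose A := \sum_k mu x k * \sum_j mu x j * b (y k) j.
have A0 : 0 <= A + A.
  have {2}-> : A = \sum_k \sum_j mu x k * (mu x j * b (y j) k).
    rewrite exchange_big; apply: eq_bigr => k _; rewrite mulr_sumr.
    by apply: eq_bigr => j _; rewrite mulrCA.
  rewrite /A -big_split; apply: sumr_ge0 => k _; rewrite mulr_sumr -big_split.
  apply: sumr_ge0 => j _ /=; rewrite -!mulrDr.
  by apply: mulr_ge0; [|apply: mulr_ge0]; rewrite ?mu_ge0// skew.
have A1 : A <= 0.
  by apply: sumr_le0 => k _; rewrite mulr_ge0_le0 ?mu_ge0// ltW.
have : \sum_k - (mu x k * \sum_j mu x j * b (y k) j) = 0.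
  by rewrite sumrN -/A; lra.
move/eqP; rewrite psumr_eq0; last first.
  by move=> k _; rewrite oppr_ge0 mulr_ge0_le0 ?mu_ge0// ltW.
move=> /allP H; move/negP: phi0; apply; apply/eqP; apply: big1 => k _.
have := H k (mem_index_enum _); rewrite /= oppr_eq0 mulf_eq0 (lt_eqF (neg k)) orbF.
by move=> /eqP ->; rewrite expr0n.
Qed.

(** Move from x a fraction h of the way to the vertex of [good_vertex].  As b is
    affine in x, the derivative of the potential in this direction is
    - 2 times the sum over j of mu x j * (b (y k) j - b x j), which is at most
    - 2 phi x by the choice of k and [mu_mul]. *)
Lemma phi_step C x h : (forall x k, K x -> \sum_j (b (y k) j - b x j) ^+ 2 <= C) -> 0 <= C ->
  K x -> 0 <= h <= 1 -> exists2 x', K x' & phi x' <= (1 - 2 * h) * phi x + h ^+ 2 * C.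
Proof.
move=> HC C0 Kx h01.
have [phi0|phi0] := eqVneq (phi x) 0.
  by exists x => //; rewrite phi0 mulr0 add0r mulr_ge0// sqr_ge0.
have [k Hk] := good_vertex phi0.
exists (toward x h (y k)); first exact: Kconvex.
have bE j : b (toward x h (y k)) j = b x j + h * (b (y k) j - b x j).
  by rewrite /b !dotpBr dotp_toward; ring.
apply: (@le_trans _ _ (\sum_j (mu x j - h * (b (y k) j - b x j)) ^+ 2)).
  apply: ler_sum => j _; rewrite {1}/mu bE.
  set w := b x j + _.
  case: (leP 0 (- w)) => H; last by rewrite expr0n sqr_ge0.
  have H1 : - b x j <= mu x j by rewrite /mu le_max lexx orbT.
  by rewrite /w in H *; rewrite lerXn2r ?nnegrE//; lra.
rewrite (eq_bigr (fun j => mu x j ^+ 2 + - (2 * h) * (mu x j * b (y k) j) +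
  - (2 * h) * (mu x j ^+ 2) + h ^+ 2 * (b (y k) j - b x j) ^+ 2)); last first.
  move=> j _. have := mu_mul x j; set u := mu x j; set w := b x j; set v := b (y k) j => H.
  have -> : (u - h * (v - w)) ^+ 2 =
      u ^+ 2 - 2 * h * (u * v) + 2 * h * (u * w) + h ^+ 2 * (v - w) ^+ 2 by ring.
  by rewrite H; ring.
rewrite !big_split/= -!mulr_sumr -/(phi x).
have h0 : 0 <= h by case/andP: h01.
have := HC x k Kx => /(ler_wpM2l (sqr_ge0 h)).
have := mulr_ge0 h0 Hk. lra.
Qed.

(** By [phi_step] the infimum of the potential cannot be positive. *)
Lemma finite_minty eps : 0 < eps -> exists2 x, K x & forall j, - eps <= b x j.
Proof.
move=> e0.
have [N N0 HN] := K_diameter; have [D D0 HD] := F_bounded.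
pose C := \sum_(j < m) (D * N) ^+ 2.
have C0 : 0 <= C by apply: sumr_ge0 => *; exact: sqr_ge0.
have HC x k : K x -> \sum_j (b (y k) j - b x j) ^+ 2 <= C.
  move=> Kx; apply: ler_sum => j _.
  have -> : b (y k) j - b x j = dotp (F (y j)) (psub x (y k)).
    by rewrite /b !dotpBr; ring.
  rewrite -[leLHS]real_normK ?num_real// lerXn2r ?nnegrE ?mulr_ge0//.
  by rewrite (le_trans (dotp_norm1 _ (HD _ (Ky j))))// ler_wpM2l// HN.
pose S := [set phi x | x in K].
have hS : has_inf S.
  split; first by have [p Kp] := K0; exists (phi p), p.
  by exists 0 => _ [x _ <-]; exact: phi_ge0.
have IS x : K x -> inf S <= phi x by move=> Kx; apply: ge_inf; [case: hS|exists x].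
have I0 : inf S <= 0.
  rewrite leNgt; apply/negP => I0; set I := inf S in IS I0.
  (* h so small that h^2 * C is absorbed by the gain 2 * h * I *)
  pose h := Num.min 2^-1 (I / (C + 1)).
  have C1 : 0 < C + 1 by rewrite ltr_wpDl.
  have h0 : 0 < h by rewrite lt_min invr_gt0 ltr0n divr_gt0.
  have h2 : h <= 2^-1 by rewrite ge_min lexx.
  have hC : h * (C + 1) <= I by rewrite -ler_pdivlMr// ge_min lexx orbT.
  have eta0 : 0 < h * I / 4 by rewrite divr_gt0// mulr_gt0.
  have [_ [x Kx <-] xI] := inf_adherent eta0 hS; rewrite -/I in xI.
  have [|x' Kx' lex'] := phi_step HC C0 Kx (h := h); first by apply/andP; split; lra.
  have := IS _ Kx'.
  have : (1 - 2 * h) * phi x <= (1 - 2 * h) * (I + h * I / 4).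
    by rewrite ler_wpM2l ?(ltW xI)//; lra.
  have : h * (h * (C + 1)) <= h * I by rewrite ler_wpM2l// ltW.
  have : 0 < h * I by rewrite mulr_gt0.
  have : 0 <= h * (h * I) by rewrite !mulr_ge0// ltW.
  have : 0 <= h * h by rewrite mulr_ge0// ltW.
  lra.
have e20 : 0 < eps ^+ 2 by rewrite exprn_gt0.
have [_ [x Kx <-] xI] := inf_adherent e20 hS.
exists x => // j.
have : mu x j ^+ 2 <= eps ^+ 2.
  rewrite (@le_trans _ _ (phi x))//; last by lra.
  by rewrite /phi (bigD1 j)//= lerDl sumr_ge0// => *; exact: sqr_ge0.
rewrite ler_pXn2r// ?nnegrE ?mu_ge0 ?(ltW e0)// /mu ge_max => /andP[_]; lra.
Qed.
End FiniteMinty.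

(** Compactness passes from finitely many test points with tolerance eps to all
    test points without tolerance. *)
Lemma minty_solution : exists2 p, K p & forall y, K y -> 0 <= dotp (F y) (psub y p).
Proof.
pose T := 'I_n -> E -> R.
pose D := [set le : seq T * R | 0 < le.2 /\ forall y : T, y \in le.1 -> K y].
pose B (le : seq T * R) := [set x | K x /\
  forall y : T, y \in le.1 -> - le.2 <= dotp (F y) (psub y x)].
have B0 le : D le -> B le !=set0.
  case: le => l eps [/= e0 Kl].
  have Kn (j : 'I_(size l)) : K (tnth (in_tuple l) j).
    by apply: Kl; exact: mem_tnth.
  have [x Kx Hx] := finite_minty Kn e0.
  exists x; split=> //= y; rewrite -(in_tupleE l) => /tnthP[j ->]; exact: Hx.
have [||//||p Kp Hp] := compact_approx Kcompact (D := D) (B := B).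
- by exists ([::], 1); split.
- move=> [l e] [l' e'] [/= e0 Kl] [/= e'0 Kl'].
  exists (l ++ l', Num.min e e').
    split=> /=; first by rewrite lt_min e0.
    by move=> y; rewrite mem_cat => /orP[/Kl|/Kl'].
  move=> x [Kx /= H]; split; split=> //= y yl.
    by rewrite (le_trans _ (H y _))// ?lerN2 ?ge_min ?lexx// mem_cat yl.
  by rewrite (le_trans _ (H y _))// ?lerN2 ?ge_min ?lexx ?orbT// mem_cat yl orbT.
- by move=> le _ x [].
exists p => // y Ky; have [C C0 HC] := F_bounded.
have P0 := @pdim_ge0 R n E.
apply/ler_addgt0Pr => e e0.
have De : D ([:: y], e / 2).
  by split=> /=; [rewrite divr_gt0|move=> z; rewrite inE => /eqP ->].
pose r := e / 2 / (C * pdim R n E + 1).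
have CP : 0 < C * pdim R n E + 1 by rewrite ltr_wpDl// mulr_ge0.
have r0 : 0 < r by rewrite !divr_gt0.
have [x [Kx Hx] px] := Hp _ De r r0.
have := Hx y (mem_head _ _); rewrite /=.
have := dotp_norm1 (psub p x) (HC y Ky).
have : C * norm1 (psub p x) <= e / 2.
  rewrite (@le_trans _ _ (C * (pdim R n E * r)))//.
    by rewrite ler_wpM2l// norm1_le.
  rewrite mulrA (@le_trans _ _ ((C * pdim R n E + 1) * r))//.
    by rewrite ler_wpM2r ?lerDl// ltW.
  by rewrite /r mulrC divfK// gt_eqF.
by rewrite ler_norml !dotpBr => H1 /andP[H2 H3] H4; lra.
Qed.

(** Minty's lemma: test against points on the segment from p to y close to p and
    let them tend to p. *)
Lemma stampacchia_solution : exists2 p, K p & forall y, K y -> dotp (F p) (psub p y) <= 0.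
Proof.
have [p Kp Hp] := minty_solution; exists p => // y Ky.
pose N := norm1 (psub y p); have N0 : 0 <= N by exact: norm1_ge0.
apply/ler_addgt0Pr => e e0; rewrite add0r.
pose D := L * N * N + 1.
have D0 : 0 < D by rewrite ltr_wpDl// !mulr_ge0.
pose h := Num.min 1 (e / D).
have h0 : 0 < h by rewrite lt_min ltr01 divr_gt0.
have h1 : h <= 1 by rewrite ge_min lexx.
have hD : h * D <= e by rewrite -ler_pdivlMr// ge_min lexx orbT.
have Kh : K (toward p h y) by apply: Kconvex => //; rewrite ltW.
have Nh : norm1 (psub (toward p h y) p) = h * N.
  rewrite /N /norm1 mulr_sumr; apply: eq_bigr => i _; rewrite mulr_sumr.
  apply: eq_bigr => f _; rewrite /psub /toward addrAC subrr add0r normrM.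
  by rewrite gtr0_norm.
have := Hp _ Kh; rewrite dotpBr dotp_toward addrAC subrr add0r pmulr_rge0//.
have := dotp_norm1 (z := psub (F (toward p h y)) (F p)) (psub y p) (Flip Kh Kp).
rewrite Nh -/N ler_norml => /andP[_]; rewrite dotpBl !dotpBr.
by move: hD; rewrite /D; lra.
Qed.

(** ** The gap function *)

Definition gap x : R := sup [set dotp (F x) (psub x z) | z in K].

Definition vi_solutions : set (profile R n E) :=
  [set p | K p /\ forall z, K z -> dotp (F p) (psub p z) <= 0].

Lemma gap_has_sup x : K x -> has_sup [set dotp (F x) (psub x z) | z in K].
Proof.
move=> Kx; split; first by exists (dotp (F x) (psub x x)), x.
have [N N0 HN] := K_diameter; have [C C0 HC] := F_bounded.
exists (C * N) => _ [z Kz <-]; apply: (le_trans (ler_norm _)).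
by rewrite (le_trans (dotp_norm1 _ (HC x Kx)))// ler_wpM2l// HN.
Qed.

Lemma gap_ub x z : K x -> K z -> dotp (F x) (psub x z) <= gap x.
Proof. by move=> Kx Kz; apply: ub_le_sup; [case: (gap_has_sup Kx)|exists z]. Qed.

Lemma gap_le x M : K x -> (forall z, K z -> dotp (F x) (psub x z) <= M) -> gap x <= M.
Proof.
move=> Kx H; apply: ge_sup; first by case: (gap_has_sup Kx).
by move=> _ [z Kz <-]; exact: H.
Qed.

Lemma gap_ge0 x : K x -> 0 <= gap x.
Proof. by move=> Kx; apply: le_trans (gap_ub Kx Kx); rewrite dotpBr subrr. Qed.

Lemma vi_solutionsP x : vi_solutions x <-> K x /\ gap x <= 0.
Proof.
split=> -[Kx H]; split=> //; first exact: gap_le.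
by move=> z Kz; exact: le_trans (gap_ub Kx Kz) H.
Qed.

Lemma gap_lipschitz : exists2 M : R, 0 <= M &
  forall x y, K x -> K y -> `|gap x - gap y| <= M * norm1 (psub x y).
Proof.
have [N N0 HN] := K_diameter; have [C C0 HC] := F_bounded.
exists (L * N + C); first by rewrite addr_ge0// mulr_ge0.
have H x y : K x -> K y -> gap x - gap y <= (L * N + C) * norm1 (psub x y).
  move=> Kx Ky; rewrite lerBlDr; apply: gap_le => // z Kz.
  have -> : dotp (F x) (psub x z) = dotp (psub (F x) (F y)) (psub x z)
      + dotp (F y) (psub x y) + dotp (F y) (psub y z).
    by rewrite dotpBl !dotpBr; ring.
  rewrite mulrDl; apply: lerD; last exact: gap_ub.
  apply: lerD; apply: (le_trans (ler_norm _)).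
    2: exact: (dotp_norm1 _ (HC y Ky)).
  rewrite mulrAC (le_trans (dotp_norm1 _ (Flip Kx Ky)))// ler_wpM2l ?HN//.
  by rewrite mulr_ge0 ?norm1_ge0.
move=> x y Kx Ky; rewrite ler_norml H// andbT lerNl opprB norm1_psubC.
exact: H.
Qed.

Lemma gap_le_dist : exists2 M : R, 0 <= M &
  forall x, K x -> gap x <= M * dist x vi_solutions.
Proof.
have [M M0 HM] := gap_lipschitz; exists (M * pdim R n E).
  by rewrite mulr_ge0 ?pdim_ge0.
move=> x Kx; apply/ler_addgt0Pr => e e0.
have P0 := @pdim_ge0 R n E.
have D0 : 0 < M * pdim R n E + 1 by rewrite ltr_wpDl// mulr_ge0.
have ne : vi_solutions !=set0 by have [p Kp Hp] := stampacchia_solution; exists p.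
have [p [Kp Hp] np] := dist_near x ne (divr_gt0 e0 D0).
have gp : gap p <= 0 by exact: gap_le.
have := HM x p Kx Kp; rewrite ler_norml => /andP[_ H1].
have := ler_wpM2l M0 np.
have : (M * pdim R n E + 1) * (e / (M * pdim R n E + 1)) = e.
  by rewrite mulrC divfK// gt_eqF.
have : 0 < e / (M * pdim R n E + 1) by exact: divr_gt0.
move: (e / _) => q; lra.
Qed.

(** If points of arbitrarily small gap stayed at distance eps from the solutions,
    they would accumulate, by compactness, at a point of zero gap, which is itself
    a solution. *)
Lemma dist_le_gap eps : 0 < eps -> exists2 eta : R, 0 < eta &
  forall x, K x -> gap x <= eta -> dist x vi_solutions <= eps.
Proof.
move=> e0; apply: contrapT => none.
pose B (eta : R) := [set x | [/\ K x, gap x <= eta & eps < dist x vi_solutions]].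
have [||eta eta0|eta _ x []//|p Kp Hp] :=
    compact_approx Kcompact (D := [set eta : R | 0 < eta]) (B := B).
- by exists 1 => /=.
- move=> a b /= a0 b0; exists (Num.min a b); first by rewrite /= lt_min a0.
  by move=> x [Kx]; rewrite le_min => /andP[xa xb] dx; split; split.
- apply: contrapT => /forallNP H; apply: none; exists eta => // x Kx gx.
  by rewrite leNgt; apply/negP => dx; apply: (H x).
have [M M0 HM] := gap_lipschitz; have P0 := @pdim_ge0 R n E.
have D0 : 0 < M * pdim R n E + 1 by rewrite ltr_wpDl// mulr_ge0.
have close r x : (forall i e, `|p i e - x i e| <= r) -> norm1 (psub p x) <= pdim R n E * r.
  by move=> H; apply: norm1_le.
have gp : gap p <= 0.
  apply/ler_addgt0Pr => e e1; rewrite add0r.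
  have q0 : 0 < e / 2 / (M * pdim R n E + 1) by rewrite !divr_gt0.
  have [x [Kx gx _] /close px] := Hp (e / 2) (divr_gt0 e1 (ltr0n _ 2)) _ q0.
  have := HM p x Kp Kx; rewrite ler_norml => /andP[_ H1].
  have := ler_wpM2l M0 px.
  have : (M * pdim R n E + 1) * (e / 2 / (M * pdim R n E + 1)) = e / 2.
    by rewrite mulrC divfK// gt_eqF.
  move: (e / 2 / _) q0 => q q0; lra.
have P1 : 0 < pdim R n E + 1 by rewrite ltr_wpDl.
have q0 : 0 < eps / (pdim R n E + 1) by rewrite divr_gt0.
have [x [Kx _ dx] /close px] := Hp 1 ltr01 _ q0.
have /(dist_le x) : vi_solutions p by apply/vi_solutionsP.
rewrite norm1_psubC.
have : (pdim R n E + 1) * (eps / (pdim R n E + 1)) = eps by rewrite mulrC divfK// gt_eqF.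
move: (eps / _) q0 px => q q0 px; lra.
Qed.

(** Differentiability from the left, uniformly over the finitely many
    coordinates. *)
Lemma near_difference_quotient (x : R -> profile R n E) (d : profile R n E) t rho :
  (forall i e, is_derive t (1 : R) (fun s => x s i e : R) (d i e)) -> 0 < rho ->
  exists2 r, 0 < r & forall s, t - r < s < t ->
    forall i e, `|(x t i e - x s i e) - (t - s) * d i e| <= rho * (t - s).
Proof.
move=> dx rho0.
have : \forall h \near (0 : R)^', forall i e,
    `|d i e - h^-1 * (x (h + t) i e - x t i e)| < rho.
  apply: (@filter_forall _ _ (fun i h => forall e,
    `|d i e - h^-1 * (x (h + t) i e - x t i e)| < rho) _ _) => i.
  apply: (@filter_forall _ _ (fun e h =>
    `|d i e - h^-1 * (x (h + t) i e - x t i e)| < rho) _ _) => e.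
  have [Hd Hv] := dx i e.
  have : h^-1 *: (((fun s => x s i e : R) \o shift t) (h *: (1:R)) - x t i e)
      @[h --> (0:R)^'] --> d i e by rewrite -Hv; exact: Hd.
  move/cvgrPdist_lt => /(_ rho rho0); apply: filterS => h /=.
  by rewrite /GRing.scale/= mulr1.
move=> /nbhs_ballP[r /= r0 H]; exists r => // s /andP[rs st] i e.
have := H (s - t); rewrite -ball_normE /ball_/= sub0r normrN subrK => /(_ _ _ i e) Hh.
have ts : 0 < t - s by rewrite subr_gt0.
have st0 : s - t != 0 by rewrite subr_eq0 lt_eqF.
have : `|d i e - (s - t)^-1 * (x s i e - x t i e)| < rho.
  by apply: Hh => //; rewrite distrC gtr0_norm//; lra.
set q := d i e - _ => Hq.
have -> : x t i e - x s i e - (t - s) * d i e = - (q * (t - s)).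
  by rewrite /q; field.
by rewrite normrN normrM (gtr0_norm ts) ler_pM2r// ltW.
Qed.

(** The Lyapunov estimate.  Since y attains the gap at x t, while the gap at x s
    is at least its value at the test point y, it suffices to bound the increment
    of <F (x s), x s - y> as a function of s; no differentiability of the gap is
    needed.  The velocity y - x t is close to the difference quotient
    of x, so the variation of F contributes, up to o(t - s), minus the pairing of
    two increments, which is nonpositive by monotonicity; the variation of x
    contributes the pairing of F (x t) with the velocity, that is - gap (x t). *)
Lemma gap_left_increment (x : R -> profile R n E) y t eps :
  0 < t -> (forall s, 0 <= s -> K (x s)) -> K y ->
  (forall z, K z -> dotp (F (x t)) y <= dotp (F (x t)) z) ->
  (forall i e, is_derive t (1 : R) (fun s => x s i e : R) (y i e - x t i e)) ->
  0 < eps ->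
  exists2 r, 0 < r & forall s, 0 <= s -> t - r < s < t ->
    gap (x t) - gap (x s) <= (eps - gap (x t)) * (t - s).
Proof.
move=> t0 Kx Ky ymin dx e0.
pose d := psub y (x t); have Kt := Kx t (ltW t0).
have P0 := @pdim_ge0 R n E.
have [C C0 HC] := F_bounded; have N0 := norm1_ge0 d.
(* A bounds all error terms, per unit of rho * (t - s) *)
pose A := pdim R n E * (L * (norm1 d + pdim R n E) + C) + 1.
have A0 : 0 < A by rewrite ltr_wpDl// mulr_ge0// addr_ge0// mulr_ge0// addr_ge0.
pose rho := Num.min 1 (eps / A).
have rho0 : 0 < rho by rewrite lt_min ltr01 divr_gt0.
have rho1 : rho <= 1 by rewrite ge_min lexx.
have rhoA : rho * A <= eps by rewrite -ler_pdivlMr// ge_min lexx orbT.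
have [r r0 Hr] := near_difference_quotient dx rho0.
exists r => // s s0 sr; have Ks := Kx s s0; have {}Hr := Hr s sr.
have ts : 0 < t - s by case/andP: sr => _; rewrite subr_gt0.
move: Hr ts; move: (t - s) => tau Hr tau0.
(* the deviation of the increment of x from its linear approximation *)
pose w : profile R n E := fun i e => (x t i e - x s i e) - tau * d i e.
have nw : norm1 w <= pdim R n E * (rho * tau) by apply: norm1_le.
have xw z : dotp z (psub (x t) (x s)) = tau * dotp z d + dotp z w.
  rewrite /dotp mulr_sumr -big_split; apply: eq_bigr => i _ /=.
  rewrite mulr_sumr -big_split; apply: eq_bigr => e _ /=.
  by rewrite /w /psub; ring.
have nx : norm1 (psub (x t) (x s)) <= tau * (norm1 d + pdim R n E).
  apply: (@le_trans _ _ (tau * norm1 d + norm1 w)).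
    rewrite /norm1 mulr_sumr -big_split; apply: ler_sum => i _ /=.
    rewrite mulr_sumr -big_split; apply: ler_sum => e _ /=.
    rewrite -[X in X * _](gtr0_norm tau0) -normrM (le_trans _ (ler_normD _ _))//.
    by rewrite /w addrC subrK.
  rewrite mulrDr lerD2l (le_trans nw)// [leRHS]mulrC ler_wpM2l//.
  by rewrite ler_piMl// ltW.
have gt : gap (x t) = - dotp (F (x t)) d.
  apply/eqP; rewrite eq_le; apply/andP; split.
    by apply: gap_le => // z Kz; rewrite !dotpBr; have := ymin z Kz; lra.
  by have := gap_ub Kt Ky; rewrite !dotpBr; lra.
have gs := gap_ub Ks Ky.
have mono := Fmono Kt Ks.
pose B := L * (norm1 d + pdim R n E) * (pdim R n E * rho).
have Fw : dotp (F (x t)) w <= C * (pdim R n E * rho) * tau.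
  apply: (le_trans (ler_norm _)); apply: (le_trans (dotp_norm1 _ (HC _ Kt))).
  have -> : C * (pdim R n E * rho) * tau = C * (pdim R n E * (rho * tau)) by ring.
  by apply: ler_wpM2l.
have Dw : dotp (psub (F (x t)) (F (x s))) w <= tau * (B * tau).
  apply: (le_trans (ler_norm _)); apply: (le_trans (dotp_norm1 _ (Flip Kt Ks))).
  have -> : tau * (B * tau) =
      L * (tau * (norm1 d + pdim R n E)) * (pdim R n E * (rho * tau)).
    by rewrite /B; ring.
  by rewrite ler_pM ?mulr_ge0 ?norm1_ge0// ler_wpM2l.
have Dd : - dotp (psub (F (x t)) (F (x s))) d <= B * tau.
  rewrite -(ler_pM2l tau0) mulrN lerNl.
  by move: mono Dw; rewrite (xw (psub _ _)); lra.
have rA : (B + C * (pdim R n E * rho)) * tau <= eps * tau.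
  rewrite ler_wpM2r ?(ltW tau0)//; apply: le_trans rhoA; rewrite /A /B.
  by have := ltW rho0; lra.
rewrite gt; move: gs Dd Fw mono rA; have := xw (F (x t)); rewrite /d !(dotpBr, dotpBl).
by lra.
Qed.

(** ** Stability of the best-response dynamic *)

Definition fw_curves : set (R -> profile R n E) := [set x |
  [/\ forall t, 0 <= t -> K (x t),
      absolutely_continuous_curve x &
      {ae lebesgue_measure, forall t : R, 0 <= t ->
         exists2 y, K y /\ (forall z, K z -> dotp (F (x t)) y <= dotp (F (x t)) z) &
           forall i e, is_derive t (1 : R) (fun s => x s i e : R)
                         (y i e - x t i e)}]].

Section Trajectory.
Context (x : R -> profile R n E) (xfw : fw_curves x).

Lemma gap_ac_on T : 0 <= T -> ac_on T (fun t => gap (x t)).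
Proof.
have [Kx xac _] := xfw; move=> T0 eps e0; have [M M0 HM] := gap_lipschitz.
have P0 := @pdim_ge0 R n E.
have D0 : 0 < M * pdim R n E + 1 by rewrite ltr_wpDl// mulr_ge0.
have [delta d0 Hd] := xac _ T0 _ (divr_gt0 e0 D0).
exists delta => // m a b ab tI len.
apply: (@le_lt_trans _ _ ((M * pdim R n E + 1) *
    \sum_k profile_norm (fun i e => x (b k) i e - x (a k) i e))); last first.
  by rewrite mulrC -ltr_pdivlMr//; exact: Hd.
rewrite mulr_sumr; apply: ler_sum => k _.
have [a0 [le_ab bT]] := ab k.
apply: (le_trans (HM _ _ (Kx _ (le_trans a0 le_ab)) (Kx _ a0))).
have PN : 0 <= profile_norm (psub (x (b k)) (x (a k))) by exact: sqrtr_ge0.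
apply: (@le_trans _ _ (M * (pdim R n E * profile_norm (psub (x (b k)) (x (a k)))))).
  by rewrite ler_wpM2l// norm1_le_norm.
by rewrite mulrDl mul1r mulrA lerDl.
Qed.

(** [gap_left_increment] holds at almost every time, with an eps that is let tend
    to 0 after integration. *)
Lemma gap_increment_le S T c : 0 <= S -> S <= T ->
  (forall t, S <= t <= T -> c <= gap (x t)) ->
  gap (x T) - gap (x S) <= - c * (T - S).
Proof.
have [Kx _ xae] := xfw; move=> S0 ST cle; apply/ler_addgt0Pr => e e0.
have D0 : 0 < T - S + 1 by rewrite ltr_wpDl// subr_ge0.
pose eps := e / (T - S + 1); have eps0 : 0 < eps by exact: divr_gt0.
have H : gap (x T) - gap (x S) <= (eps - c) * (T - S).
  apply: (@ac_on_left_increment R S T _ (eps - c) _ S0 ST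
    (gap_ac_on (le_trans S0 ST)) xae) => t /andP[St tT] /contrapT xt.
  have t0 : 0 < t := le_lt_trans S0 St.
  have [y [Ky ymin] yder] := xt (ltW t0).
  have [r r0 Hr] := gap_left_increment t0 Kx Ky ymin yder eps0.
  exists r => // s Ss sr; apply: (le_trans (Hr s (le_trans S0 Ss) sr)).
  rewrite ler_wpM2r//; first by case/andP: sr => _; rewrite subr_ge0 => /ltW.
  by rewrite lerD2l lerN2 cle// tT ltW.
apply: (le_trans H); rewrite mulrDl addrC lerD2l.
have : eps * (T - S + 1) = e by rewrite /eps divfK// gt_eqF.
by lra.
Qed.

Lemma gap_nonincreasing S T : 0 <= S -> S <= T -> gap (x T) <= gap (x S).
Proof.
have [Kx _ _] := xfw.
move=> S0 ST; rewrite -subr_le0 -[leRHS](mul0r (T - S)) -oppr0.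
by apply: gap_increment_le => // t /andP[St _]; exact/gap_ge0/Kx/(le_trans S0).
Qed.

(** The gap is nonincreasing and decreases at least at the rate of its current
    value, hence on [0, T] at least at the rate of its final value.  This already
    forces it to 0, without the exponential bound. *)
Lemma gap_decay T : 0 <= T -> (1 + T) * gap (x T) <= gap (x 0).
Proof.
move=> T0; have := @gap_increment_le 0 T (gap (x T)) (lexx _) T0.
rewrite subr0 => H; have : gap (x T) - gap (x 0) <= - gap (x T) * T.
  by apply: H => t /andP[t0 tT]; exact: gap_nonincreasing.
by lra.
Qed.

Lemma dist_trajectory_cvg : dist (x t) vi_solutions @[t --> +oo] --> (0 : R).
Proof.
have [Kx _ _] := xfw; apply/cvgrPdist_le => e e0.
have [eta eta0 Heta] := dist_le_gap e0.
have g0 := gap_ge0 (Kx _ (lexx 0)).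
near=> t.
have t0 : 0 <= t by near: t; exact: nbhs_pinfty_ge.
have tg : gap (x 0) / eta <= t by near: t; apply: nbhs_pinfty_ge; exact: num_real.
have ne : vi_solutions !=set0 by have [p Kp Hp] := stampacchia_solution; exists p.
rewrite sub0r normrN ger0_norm ?dist_ge0//.
apply: Heta; first exact: Kx.
have t1 : 0 < 1 + t by rewrite ltr_pwDl.
rewrite -(ler_pM2l t1); apply: (le_trans (gap_decay t0)).
by move: tg; rewrite ler_pdivrMr//; lra.
Unshelve. all: by end_near.
Qed.

End Trajectory.

(** The gap is comparable to the distance to its zero set, in the sense of
    [gap_le_dist] and [dist_le_gap]; as it never increases, it serves as
    Lyapunov function. *)
Lemma fw_curves_stable : globally_asymptotically_stable fw_curves vi_solutions.
Proof.
split; last exact: dist_trajectory_cvg.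
move=> eps e0; have [eta eta0 Heta] := dist_le_gap e0.
have [M M0 HM] := gap_le_dist.
have M1 : 0 < M + 1 by rewrite ltr_wpDl.
exists (eta / (M + 1)); first exact: divr_gt0.
move=> x xfw d0 t t0; have [Kx _ _] := xfw.
apply: Heta; first exact: Kx.
apply: (le_trans (gap_nonincreasing xfw (lexx 0) t0)).
apply: (le_trans (HM _ (Kx _ (lexx 0)))); apply: (le_trans (ler_wpM2l M0 d0)).
have : (M + 1) * (eta / (M + 1)) = eta by rewrite mulrC divfK// gt_eqF.
have : 0 < eta / (M + 1) by exact: divr_gt0.
by lra.
Qed.

End VariationalInequality.

(** * Splittable congestion games *)

Section CongestionGame.
Context {R : realType} {n : nat} (hn : (2 <= n)%N) {E : finType} (G : game R n E).
Context (hQ : forall e, Q_class n (cost G e)).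
Local Notation K := (profiles G).
Local Notation F := (marginal_cost G).
Implicit Types (x y z : profile R n E).

Lemma profiles_nonempty : K !=set0.
Proof.
have [x Kx] := choice (fun i => strategies_nonempty G i).
by exists x.
Qed.

Lemma strategies_toward i (u v : E -> R) h : strategies G i u -> strategies G i v ->
  0 <= h <= 1 -> strategies G i (fun e => u e + h * (v e - u e)).
Proof.
move=> Ku Kv /andP[h0 h1].
have := @strategies_convex _ _ _ G i v u (Itv01 h0 h1).
rewrite !inE => /(_ Kv Ku); rewrite /conv/=; congr (strategies G i _).
apply/funext => e; rewrite /GRing.scale/= /unstable.onem.
change (h * v e + (1 - h) * u e = u e + h * (v e - u e)); ring.
Qed.

Lemma profiles_toward x y (h : R) : K x -> K y -> 0 <= h <= 1 -> K (toward x h y).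
Proof. by move=> Kx Ky h01 i; apply: strategies_toward. Qed.

Lemma profiles_compact : compact (K : set (@profile_top R n E)).
Proof. by apply: tychonoff => i; exact: strategies_compact. Qed.

Lemma profiles_ge0 x : K x -> forall i e, 0 <= x i e.
Proof. by move=> Kx i e; exact: strategies_ge0 (Kx i) e. Qed.

Lemma profiles_dfwith x i v : K x -> strategies G i v -> K (dfwith x i v).
Proof.
move=> Kx Kv j; have [->|ji] := eqVneq j i; first by rewrite dfwithin.
by rewrite dfwithout// eq_sym.
Qed.

Lemma load_ge0 x e : K x -> 0 <= load x e.
Proof. by move=> Kx; apply: sumr_ge0 => i _; exact: profiles_ge0. Qed.

Lemma load_le_norm1 x e : `|load x e| <= norm1 x.
Proof.
rewrite /load /norm1 (le_trans (ler_norm_sum _ _ _))//; apply: ler_sum => i _.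
by rewrite (bigD1 e)//= lerDl sumr_ge0.
Qed.

Lemma load_psub x y e : load x e - load y e = load (psub x y) e.
Proof. by rewrite /load -sumrB. Qed.

Lemma marginal_cost_monotone x y : K x -> K y ->
  0 <= dotp (psub (F x) (F y)) (psub x y).
Proof.
move=> Kx Ky; rewrite /dotp exchange_big; apply: sumr_ge0 => e _.
exact: (marginal_monotone hn (hQ e) (u := fun i => x i e) (v := fun i => y i e)
  (fun i => profiles_ge0 Kx i e) (fun i => profiles_ge0 Ky i e)).
Qed.

Lemma profiles_bounded : exists2 B : R, 0 <= B & forall x, K x -> norm1 x <= B.
Proof.
have [B B0 HB] := K_bounded profiles_compact.
by exists (pdim R n E * B); [rewrite mulr_ge0 ?pdim_ge0|move=> x Kx; apply: norm1_le; exact: HB].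
Qed.

Lemma marginal_cost_lipschitz : exists2 L : R, 0 <= L &
  forall x y, K x -> K y -> forall i e, `|F x i e - F y i e| <= L * norm1 (psub x y).
Proof.
have [M M0 HM] := profiles_bounded.
have lip e : exists2 L : R, 0 <= L & forall x y, K x -> K y -> forall i,
    `|F x i e - F y i e| <= L * norm1 (psub x y).
  pose c := cost G e; pose c' := derive_Rplus c.
  have dc s : 0 <= s -> derivable_Rplus c s := Q_class_derivable (hQ e) (x := s).
  have dc' s : 0 <= s -> derivable_Rplus c' s := Q_class_derivable2 (hQ e) (x := s).
  have cc' : {within Rplus, continuous c'} := derivable_Rplus_continuous dc'.
  have cc'' : {within Rplus, continuous (derive_Rplus c')}.
    by case: (hQ e) => -[[]].
  have [L1 L10 H1] := lipschitz_Rplus M dc cc'.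
  have [L2 L20 H2] := lipschitz_Rplus M dc' cc''.
  have [B HB] := bounded_Rplus M cc'.
  exists (L1 + (M * L2 + `|B|)); first by rewrite !addr_ge0// mulr_ge0.
  move=> x y Kx Ky i.
  have lo z : K z -> 0 <= load z e <= M.
    move=> Kz; rewrite load_ge0//= (le_trans _ (HM z Kz))//.
    by rewrite (le_trans _ (load_le_norm1 z e))// ler_norm.
  have dl : `|load x e - load y e| <= norm1 (psub x y).
    by rewrite load_psub load_le_norm1.
  have -> : F x i e - F y i e = (c (load x e) - c (load y e)) +
     (x i e * (c' (load x e) - c' (load y e)) + psub x y i e * c' (load y e)).
    by rewrite /marginal_cost /psub -/c -/c'; ring.
  have := ler_coord_norm1 (psub x y) i e.
  move: (psub x y i e) dl; move: (norm1 (psub x y)) => N d dl dN.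
  rewrite mulrDl (mulrDl (M * L2)).
  apply: (le_trans (ler_normD _ _)); apply: lerD.
    by apply: (le_trans (H1 _ _ (lo x Kx) (lo y Ky))); rewrite ler_wpM2l.
  apply: (le_trans (ler_normD _ _)); apply: lerD; rewrite normrM.
    rewrite -mulrA ler_pM//.
      by rewrite (le_trans (ler_coord_norm1 _ _ _))// HM.
    by apply: (le_trans (H2 _ _ (lo x Kx) (lo y Ky))); rewrite ler_wpM2l.
  rewrite mulrC ler_pM//.
  by rewrite (le_trans (HB _ (lo y Ky)))// ler_norm.
have [L HL] := choice (fun e => let: ex_intro2 l l0 Hl := lip e in ex_intro _ l (conj l0 Hl)).
exists (\sum_e L e); first by apply: sumr_ge0 => e _; case: (HL e).
move=> x y Kx Ky i e; have [L0 H] := HL e.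
apply: (le_trans (H x y Kx Ky i)); rewrite ler_wpM2r ?norm1_ge0//.
by rewrite (bigD1 e)//= lerDl sumr_ge0// => f _; case: (HL f).
Qed.

(** Convexity of the private cost in the player's own strategy, as a tangent
    inequality summed over the resources. *)
Lemma private_cost_tangent x i v : K x -> strategies G i v ->
  \sum_e F x i e * (v e - x i e) <= private_cost G i (dfwith x i v) - private_cost G i x.
Proof.
move=> Kx Kv; have Kxv := profiles_dfwith Kx Kv.
rewrite /private_cost -sumrB; apply: ler_sum => e _.
have := @own_cost_tangent R n hn (cost G e) (hQ e) (fun j => x j e)
  (fun j => dfwith x i v j e) i (fun j => profiles_ge0 Kx j e)
  (fun j => profiles_ge0 Kxv j e).
rewrite dfwithin; apply => j ji; rewrite dfwithout// eq_sym//.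
Qed.

Lemma dotp_own (z x : profile R n E) i v :
  dotp z (psub x (dfwith x i v)) = \sum_e z i e * (x i e - v e).
Proof.
rewrite /dotp (bigD1 i)//= [X in _ + X]big1 ?addr0.
  by apply: eq_bigr => e _; rewrite /psub dfwithin.
move=> j ji; apply: big1 => e _.
by rewrite /psub dfwithout 1?eq_sym// subrr mulr0.
Qed.

Lemma vi_nash : vi_solutions K F `<=` nash_equilibria G.
Proof.
move=> x [Kx vi]; split=> // i v Kv; rewrite -subr_ge0.
apply: le_trans (private_cost_tangent Kx Kv).
have := vi _ (profiles_dfwith Kx Kv); rewrite dotp_own -oppr_ge0 -sumrN.
by congr (0 <= _); apply: eq_bigr => e _; ring.
Qed.

(** First-order condition at an equilibrium.  Deviate by a fraction h towards v:
    the deviation does not pay, so by the tangent inequality at the deviated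
    profile the marginal costs there pair nonnegatively with v - x i.  Let h tend
    to 0 and use that the marginal costs are Lipschitz. *)
Lemma nash_own_direction x i v : nash_equilibria G x -> strategies G i v ->
  \sum_e F x i e * (x i e - v e) <= 0.
Proof.
move=> [Kx nash] Kv; have [L L0 HL] := marginal_cost_lipschitz.
pose w h e := x i e + h * (v e - x i e).
pose xh h := dfwith x i (w h).
pose N := \sum_e `|v e - x i e|; have N0 : 0 <= N by exact: sumr_ge0.
have Kw h : 0 <= h <= 1 -> strategies G i (w h) by exact: strategies_toward.
have Kh h : 0 <= h <= 1 -> K (xh h) by move=> h01; apply: profiles_dfwith => //; exact: Kw.
have nh h : 0 <= h -> norm1 (psub (xh h) x) = h * N.
  move=> h0; rewrite /norm1 (bigD1 i)//= [X in _ + X]big1 ?addr0.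
    rewrite /N mulr_sumr; apply: eq_bigr => e _.
    by rewrite /psub /xh dfwithin /w addrAC subrr add0r normrM ger0_norm.
  move=> j ji; apply: big1 => e _.
  by rewrite /psub /xh dfwithout 1?eq_sym// subrr normr0.
apply/ler_addgt0Pr => e e0; rewrite add0r.
pose D := L * N * N + 1; have D0 : 0 < D by rewrite ltr_wpDl// !mulr_ge0.
pose h := Num.min 1 (e / D).
have h0 : 0 < h by rewrite lt_min ltr01 divr_gt0.
have h01 : 0 <= h <= 1 by rewrite ltW//= ge_min lexx.
have hD : h * D <= e by rewrite -ler_pdivlMr// ge_min lexx orbT.
have : 0 <= \sum_f F (xh h) i f * (v f - x i f).
  have back : dfwith (xh h) i (x i) = x.
    apply/funext => j; have [->|ji] := eqVneq j i; first by rewrite dfwithin.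
    by rewrite dfwithout 1?eq_sym// /xh dfwithout// eq_sym.
  have := private_cost_tangent (Kh h h01) (Kx i); rewrite back => H.
  have := nash i _ (Kw h h01); rewrite -/(xh h) => Hn.
  rewrite -(pmulr_rge0 _ h0) mulr_sumr.
  rewrite (eq_bigr (fun f => - (F (xh h) i f * (x i f - xh h i f)))).
    by rewrite sumrN oppr_ge0 (le_trans H)// subr_le0.
  move=> f _; have -> : xh h i f = w h f by rewrite /xh dfwithin.
  by rewrite /w; ring.
have : \sum_f (F (xh h) i f - F x i f) * (v f - x i f) <= L * (h * N) * N.
  rewrite {2}/N mulr_sumr; apply: ler_sum => f _.
  apply: (le_trans (ler_norm _)); rewrite normrM ler_wpM2r//.
  by rewrite -nh ?(ltW h0)//; apply: HL => //; exact: Kh.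
have -> : \sum_f (F (xh h) i f - F x i f) * (v f - x i f) =
    \sum_f F (xh h) i f * (v f - x i f) + \sum_f F x i f * (x i f - v f).
  by rewrite -big_split; apply: eq_bigr => f _ /=; ring.
move: hD; rewrite /D; lra.
Qed.

(** The pairing in the variational inequality is a sum over the players of the
    pairings controlled by [nash_own_direction]. *)
Lemma nash_vi : nash_equilibria G `<=` vi_solutions K F.
Proof.
move=> x nx; split; first by case: nx.
move=> z Kz; apply: sumr_le0 => i _; exact: nash_own_direction nx (Kz i).
Qed.

Lemma nash_equilibriaE : nash_equilibria G = vi_solutions K F.
Proof. by apply/seteqP; split; [exact: nash_vi|exact: vi_nash]. Qed.

End CongestionGame.

Theorem corollary1 (R : realType) (n : nat) (hn : (2 <= n)%N) (E : finType)
    (G : game R n E) (hQ : forall e : E, Q_class n (cost G e)) :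
  nash_equilibria G !=set0 /\
  globally_asymptotically_stable (frank_wolfe_solution G) (nash_equilibria G).
Proof.
have [L L0 HL] := marginal_cost_lipschitz hQ.
have K0 := profiles_nonempty G.
have Kconv := @profiles_toward _ _ _ G.
have Kcomp := profiles_compact (G := G).
have Fmono := marginal_cost_monotone hn hQ.
rewrite (nash_equilibriaE hn hQ); split.
  by have [p Kp Hp] := stampacchia_solution K0 Kconv Kcomp L0 HL Fmono; exists p.
(* frank_wolfe_solution G unfolds to fw_curves for the marginal costs *)
exact: (fw_curves_stable K0 Kconv Kcomp L0 HL Fmono).
Qed.
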